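(* Let $d \geq 5$ and let \[ S_{4,d}(x_0,\dots,x_5) = x_0x_1^{d-1} + x_1x_2^{d-1} + x_2x_3^{d-1} + x_3x_4^{d-1} + x_4x_0^{d-1} + x_5^d. \] Then $\operatorname{sr}(S_{4,d}) = 4$.
   Context: The slice rank $\operatorname{sr}(F)$ of a homogeneous polynomial $F$ over $\mathbb{C}$ is the minimal $r$ such that $F=\sum_{k=1}^r L_k H_k$ with $L_k$ linear forms and $H_k$ homogeneous polynomials. *)

(* Defs.v *)
From HB Require Import structures.
From mathcomp Require Import all_boot all_order all_algebra.
From mathcomp Require Import complex reals.
From mathcomp Require Import mpoly.

Set Implicit Arguments.
Unset Strict Implicit.
Unset Printing Implicit Defensive.

Import GRing.Theory.
Local Open Scope ring_scope.

(* No condition is put on the degrees of the [H k]; note that the zero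
   polynomial is homogeneous of every degree. *)
Definition has_slice_decomposition (K : fieldType) (n : nat)
    (F : {mpoly K[n]}) (r : nat) : Prop :=
  exists L H : 'I_r -> {mpoly K[n]},
    [/\ forall k, L k \is 1.-homog,
        forall k, exists e : nat, H k \is e.-homog
      & F = \sum_(k < r) L k * H k].

(* [sr(F) = r], stated as a relation because a nonzero constant has no slice
   decomposition. *)
Definition is_slice_rank (K : fieldType) (n : nat)
    (F : {mpoly K[n]}) (r : nat) : Prop :=
  has_slice_decomposition F r /\
  forall s : nat, has_slice_decomposition F s -> (r <= s)%N.

Definition S4 (K : fieldType) (d : nat) : {mpoly K[6]} :=
  let x0 := 'X_(inord 0%N) in let x1 := 'X_(inord 1%N) in
  let x2 := 'X_(inord 2%N) in let x3 := 'X_(inord 3%N) in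
  let x4 := 'X_(inord 4%N) in let x5 := 'X_(inord 5%N) in
  x0 * x1 ^+ (d - 1) + x1 * x2 ^+ (d - 1) + x2 * x3 ^+ (d - 1)
  + x3 * x4 ^+ (d - 1) + x4 * x0 ^+ (d - 1) + x5 ^+ d.

(* Main.v *)
Require Import Defs.
From HB Require Import structures.
From mathcomp Require Import all_boot all_order all_algebra.
From mathcomp Require Import complex reals.
From mathcomp Require Import mpoly.
From mathcomp Require Import ring zify.

(** A decomposition with at most three slices makes the form vanish on a
    subspace [V] of dimension at least 3. Put [n = d - 1]. On a plane inside
    [V] where [x0 = 0], the coordinates become binary linear forms with
    [x1 x2^n + x2 x3^n + x3 x4^n + x5^(n+1) = 0]. If [x2] and [x3] are
    independent there, they can serve as the variables, and comparing four
    coefficients is contradictory as soon as [n >= 4]. Otherwise unique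
    factorisation puts one of the coordinate vectors [e1], [e4] in [V].
    Translating along [e_j] forces the two neighbouring coordinates to vanish
    on [V], which leaves a relation [p q^n + x5^(n+1) = 0]; its three forms are
    then proportional on the plane [x_j = 0] of [V], and their common zero is a
    nonzero vector of [V] without nonzero coordinates. *)

Set Implicit Arguments.
Unset Strict Implicit.
Unset Printing Implicit Defensive.

Import GRing.Theory Num.Theory.
Local Open Scope ring_scope.

(** * Univariate polynomials: vanishing and coefficients *)

Lemma poly_eq0_of_horner (K : numFieldType) (p : {poly K}) :
  (forall x, p.[x] = 0) -> p = 0.
Proof.
move=> p0; apply/eqP; apply: contraT => pN0.
have := max_poly_roots (rs := [seq i%:R | i <- iota 0 (size p)]) pN0.
rewrite size_map size_iota ltnn; apply.
  by apply/allP => x _; apply/eqP/p0.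
by rewrite map_inj_uniq ?iota_uniq // => i j /eqP; rewrite eqr_nat => /eqP.
Qed.

Lemma coef_affine_exp (K : fieldType) (a b : K) n k :
  ((a *: 'X + b%:P) ^+ n)`_k = a ^+ k * b ^+ (n - k) *+ 'C(n, k).
Proof.
rewrite addrC exprDn coef_sum.
have E (i : 'I_n.+1) :
    ((b%:P ^+ (n - i) * (a *: 'X) ^+ i *+ 'C(n, i)) : {poly K})`_k =
    if k == i :> nat then a ^+ k * b ^+ (n - k) *+ 'C(n, k) else 0.
  rewrite coefMn -polyC_exp exprZn coefCM coefZ coefXn.
  by case: eqP => [->|_]; rewrite ?mulr1 ?mulr0 ?mul0rn // mulrC.
rewrite (eq_bigr _ (fun i _ => E i)).
have [kn|nk] := ltnP k n.+1.
  rewrite (bigD1 (Ordinal kn)) //= eqxx big1 ?addr0 // => i iN.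
  by rewrite ifN //; apply: contraNneq iN => ki; apply/eqP/val_inj.
rewrite big1 ?bin_small ?mulr0n // => i _.
by rewrite ifN //; apply: contraTneq nk => ->; rewrite -ltnNge.
Qed.

(** * Relations between binary linear forms *)

Section BinaryForms.
Variable K : numFieldType.
Implicit Types p q r a b c e f z y : K * K.

Definition lin p z : K := z.1 * p.1 + z.2 * p.2.

Lemma linD p y z k :
  lin p (y.1 + k * z.1, y.2 + k * z.2) = lin p y + k * lin p z.
Proof. by rewrite /lin /=; ring. Qed.

Lemma lin_zero p : exists2 z, z != (0, 0) & lin p z = 0.
Proof.
have [->|pN0] := eqVneq p (0, 0).
  by exists (1, 0); rewrite /lin /= ?mulr0 ?addr0 // xpair_eqE oner_eq0.
exists (p.2, - p.1); last by rewrite /lin /=; ring.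
by rewrite xpair_eqE oppr_eq0 andbC -xpair_eqE -surjective_pairing.
Qed.

Lemma lin_one p : p != (0, 0) -> exists y, lin p y = 1.
Proof.
rewrite [p]surjective_pairing xpair_eqE negb_and => /orP[pN0|pN0].
  by exists (p.1^-1, 0); rewrite /lin /= mul0r addr0 mulVf.
by exists (0, p.2^-1); rewrite /lin /= mul0r add0r mulVf.
Qed.

(** Wherever [q] vanishes, so does [r]; if [q] is zero, any zero of [p] works. Otherwise, moving
    from a point with [q = 1] along a zero [z] of [q] changes neither [q] nor [r], hence not [p], so
    [p] vanishes at [z]. *)
Lemma common_zero_binomial n p q r : (0 < n)%N ->
  (forall z, lin p z * lin q z ^+ n + lin r z ^+ n.+1 = 0) ->
  exists2 z, z != (0, 0) & [/\ lin p z = 0, lin q z = 0 & lin r z = 0].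
Proof.
move=> n0 E.
have rz z : lin q z = 0 -> lin r z = 0.
  move=> qz; have := E z; rewrite qz expr0n gtn_eqF // mulr0 add0r => /eqP.
  by rewrite expf_eq0 => /andP[_ /eqP].
have [q0|/lin_one[y qy]] := eqVneq q (0, 0).
  have [z zN0 pz] := lin_zero p; exists z => //.
  have qz : lin q z = 0 by rewrite q0 /lin /= !mulr0 addr0.
  by split=> //; apply: rz.
have [z zN0 qz] := lin_zero q; exists z => //.
have rz0 := rz z qz; split=> //.
have := E (y.1 + 1 * z.1, y.2 + 1 * z.2); have := E y.
rewrite !linD qz rz0 qy !mulr0 !addr0 expr1n !mulr1 mul1r => Ey.
by rewrite addrAC Ey add0r.
Qed.

(** On a line in the direction of a common zero [z] of [b] and [c], the forms [b], [c] and [f] are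
    constant. The relation becomes a polynomial in the parameter: its coefficient of degree [n]
    gives [e = 0] at [z], and then the linear one gives [a = 0] there. *)
Lemma common_zero_proportional n a b c e f : (1 < n)%N ->
  b != (0, 0) -> c != (0, 0) -> b.1 * c.2 = b.2 * c.1 ->
  (forall z, lin a z * lin b z ^+ n + lin b z * lin c z ^+ n
     + lin c z * lin e z ^+ n + lin f z ^+ n.+1 = 0) ->
  exists2 z, z != (0, 0) &
    [/\ lin a z = 0, lin b z = 0, lin c z = 0, lin e z = 0 & lin f z = 0].
Proof.
move=> n1 bN0 cN0 det0 E.
have [y by1] := lin_one bN0.
have cE : c = (b.1 * lin c y, b.2 * lin c y).
  rewrite [LHS]surjective_pairing -[c.1]mul1r -[c.2]mul1r -by1 /lin.
  by congr (_, _); ring: det0.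
have cyN0 : lin c y != 0.
  by apply: contraNneq cN0 => cy; rewrite cE cy !mulr0.
have [z zN0 bz] := lin_zero b.
have cz : lin c z = 0.
  transitivity (lin c y * lin b z); last by rewrite bz mulr0.
  by rewrite [in LHS]cE /lin /=; ring.
have fz : lin f z = 0.
  have := E z; rewrite bz cz !mul0r expr0n gtn_eqF 1?ltnW // mulr0 !add0r.
  by move/eqP; rewrite expf_eq0 => /andP[_ /eqP].
pose P := (lin c y) *: (lin e z *: 'X + (lin e y)%:P) ^+ n
  + lin a z *: 'X + (lin a y + lin c y ^+ n + lin f y ^+ n.+1)%:P.
have P0 : P = 0.
  apply: poly_eq0_of_horner => k.
  have := E (y.1 + k * z.1, y.2 + k * z.2).
  rewrite !linD bz cz fz by1 !mulr0 !addr0 /P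
    !(hornerD, hornerM, hornerZ, horner_exp, hornerX, hornerC).
  rewrite expr1n [lin e y + _]addrC [k * lin e z]mulrC => E1.
  by rewrite -[RHS]E1; ring.
have ez : lin e z = 0.
  have := congr1 (fun p : {poly K} => p`_n) P0.
  rewrite /P !coefD !coefZ coef_affine_exp coefX coefC coef0 binn subnn.
  rewrite (gtn_eqF n1) (gtn_eqF (ltnW n1)) mulr0 !addr0 mulr1 mulr1n => /eqP.
  by rewrite mulf_eq0 (negPf cyN0) /= expf_eq0 => /andP[_ /eqP].
have az : lin a z = 0.
  have := congr1 (fun p : {poly K} => p`_1) P0.
  rewrite /P !coefD !coefZ coef_affine_exp coefX coefC coef0 ez /=.
  by rewrite expr1 mul0r mul0rn mulr0 add0r addr0 mulr1.
by exists z.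
Qed.

(* In the variables [X = b], [1 = c], with [e = e0 X + e1] and [f = f0 X + f1],
   the coefficients of degree 2 and 3 give, for [r = (e0 f1) / (f0 e1)],
   [r^2 = (n+1)/(n-1)] and [r^3 = (n+1)/(n-2)], hence [3 n = 5]. *)
Lemma no_independent_solution n a b c e f : (3 < n)%N ->
  b.1 * c.2 != b.2 * c.1 ->
  (forall z, lin a z * lin b z ^+ n + lin b z * lin c z ^+ n
     + lin c z * lin e z ^+ n + lin f z ^+ n.+1 = 0) -> False.
Proof.
move=> n3 detN0 E.
set D := b.1 * c.2 - b.2 * c.1.
have DN0 : D != 0 by rewrite subr_eq0.
(* The basis dual to [b], [c]: at [w + k v] one has [b = k] and [c = 1]. *)
pose v := (c.2 / D, - c.1 / D); pose w := (- b.2 / D, b.1 / D).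
have bv : lin b v = 1 by rewrite -(divff DN0) /lin /D /=; ring.
have cv : lin c v = 0 by rewrite /lin /=; ring.
have bw : lin b w = 0 by rewrite /lin /=; ring.
have cw : lin c w = 1 by rewrite -(divff DN0) /lin /D /=; ring.
pose e0 := lin e v; pose e1 := lin e w; pose f0 := lin f v; pose f1 := lin f w.
pose P := (lin a v *: 'X + (lin a w)%:P) * 'X^n + 'X
  + (e0 *: 'X + e1%:P) ^+ n + (f0 *: 'X + f1%:P) ^+ n.+1.
have P0 : P = 0.
  apply: poly_eq0_of_horner => k.
  have := E (w.1 + k * v.1, w.2 + k * v.2).
  rewrite !linD bv cv bw cw !mulr0 !mulr1 !addr0 !add0r expr1n /P
    !(hornerD, hornerM, hornerZ, horner_exp, hornerX,
      hornerXn, hornerC).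
  rewrite [lin e w + _]addrC [k * lin e v]mulrC.
  rewrite [lin f w + _]addrC [k * lin f v]mulrC => E1.
  by rewrite -[RHS]E1 /e0 /e1 /f0 /f1; ring.
(* The term in [a] starts in degree [n > 3], so it does not enter these coefficients. *)
have C k : (k < 4)%N -> (k == 1%N)%:R + e0 ^+ k * e1 ^+ (n - k) *+ 'C(n, k)
    + f0 ^+ k * f1 ^+ (n.+1 - k) *+ 'C(n.+1, k) = 0.
  move=> k4; have := congr1 (fun p : {poly K} => p`_k) P0.
  rewrite /P !coefD !coef_affine_exp coefX coef0 coefMXn.
  by rewrite ifT ?add0r //; lia.
have C0 := C 0%N isT; have C1 := C 1%N isT.
have C2 := C 2%N isT; have C3 := C 3%N isT.
have nN0 : (n == 0%N) = false by lia.
have n1N0 : (n - 1 == 0)%N = false by lia.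
have e1N0 : e1 != 0.
  apply: contra_neqN (oner_neq0 K) => /eqP e10.
  have f10 : f1 = 0.
    move: C0; rewrite e10 !expr0 !subn0 !bin0 !mulr1n !mul1r expr0n nN0 !add0r.
    by move/eqP; rewrite expf_eq0 => /andP[_ /eqP].
  by move: C1; rewrite e10 f10 subSS subn0 !expr0n n1N0 nN0 !mulr0 !mul0rn !addr0.
have f1N0 : f1 != 0.
  apply: contraNneq e1N0 => f10; move: C0.
  rewrite f10 !expr0 !subn0 !bin0 !mulr1n !mul1r expr0n addr0 add0r.
  by move/eqP; rewrite expf_eq0 => /andP[_].
have f1E : f1 ^+ n.+1 = - e1 ^+ n.
  apply/eqP; rewrite -addr_eq0 addrC; apply/eqP; move: C0.
  by rewrite !expr0 !subn0 !bin0 !mulr1n !mul1r add0r.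
(* Multiply coefficient [k] by [e1 ^+ k * f1 ^+ k]: by [f1E] a common factor [e1 ^+ n] cancels, and
   the quotient of the two binomials is [(n+1) / (n+1-k)]. *)
have XY k : (1 < k < 4)%N ->
    (e0 * f1) ^+ k * (n.+1 - k)%:R = (f0 * e1) ^+ k * n.+1%:R.
  move=> /andP[k1 k4]; have := C k k4; rewrite gtn_eqF // add0r => Ck.
  have kn : (k <= n)%N by lia.
  have BN0 : ('C(n, k)%:R : K) != 0 by rewrite pnatr_eq0 -lt0n bin_gt0.
  have AN0 : e1 ^+ n != 0 by rewrite expf_neq0.
  have bin_eq : (n.+1 - k)%:R * 'C(n.+1, k)%:R = n.+1%:R * 'C(n, k)%:R :> K.
    by rewrite -!natrM -mul_bin_down.
  apply: (mulIf BN0); apply: (mulIf AN0).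
  have eE : e1 ^+ n = e1 ^+ (n - k) * e1 ^+ k by rewrite -exprD subnK.
  have fE : f1 ^+ (n.+1 - k) * f1 ^+ k = - e1 ^+ n.
    by rewrite -exprD subnK // ltnW.
  transitivity ((n.+1 - k)%:R * (e1 ^+ k * f1 ^+ k)
    * (e0 ^+ k * e1 ^+ (n - k) *+ 'C(n, k))).
    by rewrite eE exprMn -mulr_natr; ring.
  have -> : e0 ^+ k * e1 ^+ (n - k) *+ 'C(n, k)
      = - (f0 ^+ k * f1 ^+ (n.+1 - k) *+ 'C(n.+1, k)).
    by apply/eqP; rewrite -addr_eq0 Ck.
  transitivity (- (f1 ^+ (n.+1 - k) * f1 ^+ k) * f0 ^+ k * e1 ^+ k
    * ((n.+1 - k)%:R * 'C(n.+1, k)%:R)).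
    by rewrite -mulr_natr; ring.
  by rewrite bin_eq fE exprMn; ring.
have X2 := XY 2%N isT; have X3 := XY 3%N isT.
set X := e0 * f1 in X2 X3; set Y := f0 * e1 in X2 X3.
(* If [Y = 0], then [e0 = f0 = 0] and the coefficient of degree 1 reads [1 = 0]. *)
have YN0 : Y != 0.
  apply: contra_neqN (oner_neq0 K) => /eqP Y0.
  have /eqP := X2; rewrite Y0 expr0n mul0r mulf_eq0 pnatr_eq0 subSS n1N0 orbF expf_eq0 /=.
  rewrite mulf_eq0 (negPf f1N0) orbF => /eqP e00.
  move/eqP: Y0; rewrite mulf_eq0 (negPf e1N0) orbF => /eqP f00.
  by move: C1; rewrite e00 f00 !expr1 !mul0r !mul0rn !addr0.
(* Eliminating [X ^+ 6] between the cube of [X2] and the square of [X3] leaves, after cancellation,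
   [(n+1)(n-2)^2 = (n-1)^3]. *)
have YE : Y ^+ 6 * n.+1%:R ^+ 2 * (n.+1%:R * (n.+1 - 3)%:R ^+ 2)
        = Y ^+ 6 * n.+1%:R ^+ 2 * (n.+1 - 2)%:R ^+ 3.
  transitivity ((Y ^+ 2 * n.+1%:R) ^+ 3 * (n.+1 - 3)%:R ^+ 2); first by ring.
  rewrite -X2.
  transitivity ((X ^+ 3 * (n.+1 - 3)%:R) ^+ 2 * (n.+1 - 2)%:R ^+ 3); first by ring.
  by rewrite X3; ring.
have YnN0 : Y ^+ 6 * n.+1%:R ^+ 2 != 0.
  by rewrite mulf_neq0 // expf_neq0 // pnatr_eq0.
have := mulfI YnN0 YE; rewrite -!natrX -natrM => /eqP; rewrite eqr_nat.
have [m ->] : exists m, n = m.+4 by exists (n - 4)%N; lia.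
by rewrite !subSS !subn0 !expnS !expn0 => /eqP; nia.
Qed.

End BinaryForms.

(** * Planes inside left kernels *)

Section Kernels.
Variable K : fieldType.

Lemma exists_kernel_plane m n (A : 'M[K]_(m, n)) : (n + 2 <= m)%N ->
  exists u w : 'rV[K]_m,
    (forall s t, (s *: u + t *: w) *m A = 0) /\
    (forall s t, s *: u + t *: w = 0 -> (s, t) = (0, 0)).
Proof.
move=> nm; pose r := \rank (kermx A).
have r2 : (2 <= r)%N by rewrite /r mxrank_ker; have := rank_leq_col A; lia.
(* [pid_mx 2] selects the first two vectors of a basis of the kernel. *)
pose U : 'M_(2, m) := (pid_mx 2 : 'M_(2, r)) *m row_base (kermx A).
have UA : U *m A = 0.
  by apply/sub_kermxP; rewrite (submx_trans (submxMl _ _)) ?eq_row_base.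
have Ufree : row_free U.
  by rewrite /row_free mxrankMfree ?row_base_free // rank_pid_mx.
have comb s t : s *: row 0 U + t *: row 1 U
    = (\row_j (if j == 0 then s else t)) *m U.
  apply/rowP => j; rewrite [RHS]mxE !big_ord_recl big_ord0 addr0.
  by have -> : lift ord0 ord0 = 1 :> 'I_2; [apply: val_inj | rewrite !mxE].
exists (row 0 U), (row 1 U); split=> s t.
  by rewrite comb -mulmxA UA mulmx0.
rewrite comb => /eqP; rewrite mulmx_free_eq0 // => /eqP/rowP E.
by have := E 0; have := E 1; rewrite !mxE /= => -> ->.
Qed.

(** Appending the column [delta_mx j 0] to [A] turns the vanishing of coordinate [j] into a kernel
    condition. *)
Lemma exists_kernel_plane_coord0 m n (A : 'M[K]_(m, n)) (j : 'I_m) :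
  (n + 3 <= m)%N ->
  exists u w : 'rV[K]_m, [/\ forall s t, (s *: u + t *: w) *m A = 0,
    forall s t, (s *: u + t *: w) 0 j = 0 &
    forall s t, s *: u + t *: w = 0 -> (s, t) = (0, 0)].
Proof.
move=> nm.
pose B := row_mx A (delta_mx j 0 : 'cV_m).
have [|u [w [ker free]]] := exists_kernel_plane B; first by lia.
have kerj s t : (s *: u + t *: w) *m A = 0 /\ col j (s *: u + t *: w) = 0.
  by apply: eq_row_mx; rewrite row_mx0 colE -mul_mx_row.
exists u, w; split=> // s t; first by case: (kerj s t).
by have [_ /rowP/(_ 0)] := kerj s t; rewrite !mxE.
Qed.

End Kernels.

(** * The cyclic form on a subspace of codimension at most 3 *)

Section VanishingSubspace.
Variable K : numFieldType.

Lemma trinomial_vanishing n (a b c : K) : (1 < n)%N ->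
  (forall t, a * t ^+ n + b * t + c = 0) -> a = 0 /\ b = 0.
Proof.
move=> n1 E; pose P := a *: 'X^n + b *: 'X + c%:P.
have P0 : P = 0.
  apply: poly_eq0_of_horner => t.
  by rewrite /P !(hornerD, hornerZ, hornerXn, hornerX, hornerC).
split.
  have := congr1 (fun p : {poly K} => p`_n) P0.
  rewrite /P !coefD !coefZ coefXn coefX coefC coef0 eqxx.
  by rewrite (gtn_eqF n1) (gtn_eqF (ltnW n1)) mulr0 !addr0 mulr1.
have := congr1 (fun p : {poly K} => p`_1) P0.
rewrite /P !coefD !coefZ coefXn coefX coefC coef0 (ltn_eqF n1) /=.
by rewrite mulr0 addr0 add0r mulr1.
Qed.

(* The indices are parameters so that the cyclic symmetry is a permutation of
   the arguments. *)
Definition cyclic_form n (g j h p q r : 'I_6) (x : 'rV[K]_6) : K :=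
  x 0 g * x 0 j ^+ n + x 0 j * x 0 h ^+ n + x 0 h * x 0 p ^+ n
  + x 0 p * x 0 q ^+ n + x 0 q * x 0 g ^+ n + x 0 r ^+ n.+1.

Lemma plane_coordE (u w : 'rV[K]_6) s t i :
  (s *: u + t *: w) 0 i = lin (u 0 i, w 0 i) (s, t).
Proof. by rewrite !mxE. Qed.

Lemma plane_neq0 (u w : 'rV[K]_6) z :
  (forall s t, s *: u + t *: w = 0 -> (s, t) = (0, 0)) ->
  z != (0, 0) -> ~ (forall i, lin (u 0 i, w 0 i) z = 0).
Proof.
case: z => s t free /eqP zN0 z0; apply/zN0/free/rowP => i.
by rewrite plane_coordE z0 mxE.
Qed.

Lemma no_axis_in_kernel m n (A : 'M[K]_(6, m)) (g j h p q r : 'I_6) :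
  (m <= 3)%N -> (1 < n)%N ->
  uniq [:: g; j; h; p; q; r] -> (forall i, i \in [:: g; j; h; p; q; r]) ->
  (forall x, x *m A = 0 -> cyclic_form n g j h p q r x = 0) ->
  (delta_mx 0 j : 'rV_6) *m A <> 0.
Proof.
move=> m3 n1 unq full vanish axis.
have jN i : i \in [:: g; h; p; q; r] -> i != j.
  move=> iI; move: unq.
  rewrite (perm_uniq (permEl (perm_catCA [:: g] [:: j] [:: h; p; q; r]))).
  by rewrite cons_uniq => /andP[jN _]; apply: contraNneq jN => <-.
(* With coordinate [j] replaced by a free [t], the form is [x_g t^n + x_h^n t] plus a term constant
   in [t]. *)
have sideways (x : 'rV_6) : x *m A = 0 -> x 0 g = 0 /\ x 0 h = 0.
  move=> xA.
  suff [-> /eqP] : x 0 g = 0 /\ x 0 h ^+ n = 0.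
    by rewrite expf_eq0 => /andP[_ /eqP].
  apply: (@trinomial_vanishing n _ _ (x 0 h * x 0 p ^+ n
    + x 0 p * x 0 q ^+ n + x 0 q * x 0 g ^+ n + x 0 r ^+ n.+1)) => // t.
  pose y := x + (t - x 0 j) *: delta_mx 0 j.
  have yA : y *m A = 0 by rewrite mulmxDl xA -scalemxAl axis scaler0 addr0.
  have yj : y 0 j = t by rewrite !mxE !eqxx mulr1 addrC subrK.
  have yN i : i \in [:: g; h; p; q; r] -> y 0 i = x 0 i.
    by move=> /jN ij; rewrite !mxE (negPf ij) andbF mulr0 addr0.
  have := vanish y yA; rewrite /cyclic_form yj !yN ?inE ?eqxx ?orbT //.
  by move=> <-; ring.
have [|u [w [ker kerj free]]] := exists_kernel_plane_coord0 A j; first by lia.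
pose l i := (u 0 i, w 0 i).
have lj z : lin (l j) z = 0.
  by case: z => s t; rewrite -plane_coordE kerj.
have lgh z : lin (l g) z = 0 /\ lin (l h) z = 0.
  by case: z => s t; rewrite -!plane_coordE; apply: sideways; rewrite ker.
(* Only [x_p x_q^n + x_r^(n+1)] survives on the plane, so a common zero of these three forms kills
   all six coordinates. *)
have [||z zN0 [zp zq zr]] := @common_zero_binomial K n (l p) (l q) (l r).
- exact: ltnW.
- case=> s t; have [gz hz] := lgh (s, t).
  have := vanish _ (ker s t); rewrite /cyclic_form !plane_coordE.
  rewrite -!/(l _) gz hz lj expr0n (gtn_eqF (ltnW n1)).
  by rewrite !(mul0r, mulr0, add0r, addr0).
apply: (plane_neq0 free zN0) => i; have [gz hz] := lgh z.
by have := full i; rewrite !inE => /or4P[|||/or3P[||]] /eqP->; rewrite ?lj.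
Qed.

Lemma no_vanishing_kernel m n (A : 'M[K]_(6, m)) (x0 x1 x2 x3 x4 x5 : 'I_6) :
  (m <= 3)%N -> (3 < n)%N ->
  uniq [:: x0; x1; x2; x3; x4; x5] ->
  (forall i, i \in [:: x0; x1; x2; x3; x4; x5]) ->
  ~ (forall x, x *m A = 0 -> cyclic_form n x0 x1 x2 x3 x4 x5 x = 0).
Proof.
move=> m3 n3 unq full vanish.
have no_axis1 : (delta_mx 0 x1 : 'rV_6) *m A <> 0.
  by apply: (no_axis_in_kernel _ _ unq full vanish) => //; lia.
(* A cyclic rotation brings [x4] to the second slot and preserves the form. *)
have no_axis4 : (delta_mx 0 x4 : 'rV_6) *m A <> 0.
  have rot := permEl (perm_catCA [:: x3; x4] [:: x0; x1; x2] [:: x5]).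
  apply: (@no_axis_in_kernel m n A x3 x4 x0 x1 x2 x5) => //; first by lia.
  - by rewrite (perm_uniq rot).
  - by move=> i; rewrite (perm_mem rot).
  - by move=> x /vanish <-; rewrite /cyclic_form; ring.
have [|u [w [ker ker0 free]]] := exists_kernel_plane_coord0 A x0; first by lia.
pose l i := (u 0 i, w 0 i).
have l0 z : lin (l x0) z = 0 by case: z => s t; rewrite -plane_coordE ker0.
have E z : lin (l x1) z * lin (l x2) z ^+ n + lin (l x2) z * lin (l x3) z ^+ n
    + lin (l x3) z * lin (l x4) z ^+ n + lin (l x5) z ^+ n.+1 = 0.
  case: z => s t; have := vanish _ (ker s t).
  rewrite /cyclic_form !plane_coordE -!/(l _) l0 expr0n gtn_eqF; last by lia.
  by rewrite mul0r mulr0 add0r addr0.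
(* Such a point of the plane is a nonzero multiple of the axis vector. *)
have axis k z : z != (0, 0) -> (forall i, i != k -> lin (l i) z = 0) ->
    (delta_mx 0 k : 'rV_6) *m A = 0.
  case: z => s t zN0 lN.
  have lkN0 : lin (l k) (s, t) != 0.
    apply/eqP => lk; apply: (plane_neq0 free zN0) => i.
    by have [->|/lN] := eqVneq i k.
  have -> : delta_mx 0 k = (lin (l k) (s, t))^-1 *: (s *: u + t *: w).
    apply/rowP => i; rewrite 2!mxE plane_coordE -/(l i) eqxx /=.
    by have [->|/lN->] := eqVneq i k; rewrite ?mulVf ?mulr0.
  by rewrite -scalemxAl ker scaler0.
have lin0 i z : l i = (0, 0) -> lin (l i) z = 0.
  by move=> ->; rewrite /lin !mulr0 addr0.
have zero_exp : (0 : K) ^+ n = 0 by rewrite expr0n gtn_eqF //; lia.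
(* If [x2] vanishes on the plane, only [x1] survives at a common zero of [x3], [x4], [x5]; if [x3]
   does, only [x4] survives at one of [x1], [x2], [x5]. *)
have [b0|bN0] := eqVneq (l x2) (0, 0).
  have [||z zN0 [z3 z4 z5]] := @common_zero_binomial K n (l x3) (l x4) (l x5).
  - by lia.
  - by move=> z; have := E z; rewrite (lin0 _ _ b0) zero_exp mul0r mulr0 !add0r.
  apply/no_axis1/(axis x1 z zN0) => i.
  have := full i; rewrite !inE => /or4P[|||/or3P[||]] /eqP->; rewrite ?eqxx //.
  by rewrite (lin0 _ _ b0).
have [c0|cN0] := eqVneq (l x3) (0, 0).
  have [||z zN0 [z1 z2 z5]] := @common_zero_binomial K n (l x1) (l x2) (l x5).
  - by lia.
  - by move=> z; have := E z; rewrite (lin0 _ _ c0) zero_exp mul0r mulr0 !addr0.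
  apply/no_axis4/(axis x4 z zN0) => i.
  have := full i; rewrite !inE => /or4P[|||/or3P[||]] /eqP->; rewrite ?eqxx //.
  by rewrite (lin0 _ _ c0).
have [det0|detN0] := eqVneq ((l x2).1 * (l x3).2) ((l x2).2 * (l x3).1).
  have [|z zN0 [z1 z2 z3 z4 z5]] := common_zero_proportional _ bN0 cN0 det0 E.
    by lia.
  apply: (plane_neq0 free zN0) => i.
  by have := full i; rewrite !inE => /or4P[|||/or3P[||]] /eqP->.
exact: no_independent_solution n3 detN0 E.
Qed.

End VanishingSubspace.

(** * Slice decompositions and their common zeros *)

Section SliceDecompositions.
Variable K : fieldType.

Lemma homog1E n (L : {mpoly K[n]}) :
  L \is 1.-homog -> L = \sum_i L@_U_(i) *: 'X_i.
Proof.
move=> /dhomogP hom; apply/mpolyP => m; rewrite raddf_sum /=.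
under eq_bigr do rewrite mcoeffZ mcoeffX.
have [/mdeg1P[k /eqP->]|mN1] := boolP (mdeg m == 1%N).
  rewrite (bigD1 k) //= eqxx mulr1 big1 ?addr0 // => i ik.
  by rewrite eq_mnm1 (negPf ik) mulr0.
rewrite big1 => [|i _].
  by apply: memN_msupp_eq0; apply: contraNN mN1 => /hom ->.
have [mE|_] := eqVneq U_(i)%MM m; last by rewrite mulr0.
by rewrite -mE mdeg1 in mN1.
Qed.

Lemma meval_homog1 n (L : {mpoly K[n]}) (v : 'I_n -> K) :
  L \is 1.-homog -> L.@[v] = \sum_i v i * L@_U_(i).
Proof.
move=> /homog1E {1}->; rewrite raddf_sum; apply: eq_bigr => i _ /=.
by rewrite mevalZ mevalXU mulrC.
Qed.

Lemma homogX1 n (i : 'I_n) : ('X_i : {mpoly K[n]}) \is 1.-homog.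
Proof. by rewrite dhomogX /= mdeg1. Qed.

Lemma homogXn n (i : 'I_n) k : ('X_i ^+ k : {mpoly K[n]}) \is k.-homog.
Proof. by have := dhomogMn k (homogX1 i); rewrite mul1n. Qed.

Lemma has_slice_decomposition_S4 d : (1 < d)%N ->
  has_slice_decomposition (S4 K d) 4.
Proof.
(* From here [d] is the original degree minus 2. The variable [x1] divides the first two monomials,
   [x3] the next two, and [x4] and [x5] one each. *)
case: d => [|[|d]] // _; pose x i : {mpoly K[6]} := 'X_(inord i).
exists (fun k : 'I_4 => nth 0 [:: x 1%N; x 3%N; x 4%N; x 5%N] k).
exists (fun k : 'I_4 => nth 0 [:: x 0%N * x 1%N ^+ d + x 2%N ^+ d.+1;
  x 2%N * x 3%N ^+ d + x 4%N ^+ d.+1; x 0%N ^+ d.+1; x 5%N ^+ d.+1] k).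
have hom i j k : x i * x j ^+ d + x k ^+ d.+1 \is d.+1.-homog.
  by rewrite rpredD ?homogXn //; apply: (dhomogM (homogX1 _) (homogXn _ _)).
split.
- by case=> [[|[|[|[|k]]]]] // k4; apply: homogX1.
- by case=> [[|[|[|[|k]]]]] // k4; exists d.+1; rewrite /= ?hom ?homogXn.
rewrite !big_ord_recl big_ord0 /= /S4 subn1 /= -!/(x _) !exprS.
by ring.
Qed.

(** The columns of [A] are the coefficient vectors of the linear forms, so its left kernel is their
    common zero set. *)
Lemma slice_decomposition_kernel n r (F : {mpoly K[n]}) :
  has_slice_decomposition F r ->
  exists A : 'M[K]_(n, r), forall x : 'rV_n, x *m A = 0 -> F.@[x 0] = 0.
Proof.
move=> [L [H [homL _ ->]]].
exists (\matrix_(i, k) (L k)@_U_(i)) => x xA.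
rewrite raddf_sum big1 //= => k _; rewrite mevalM meval_homog1 //.
have /rowP/(_ k) := xA; rewrite !mxE.
by under eq_bigr do rewrite mxE; move=> ->; rewrite mul0r.
Qed.

End SliceDecompositions.

(** * The slice rank of [S4] *)

Lemma meval_S4 (K : numFieldType) d (x : 'rV[K]_6) : (0 < d)%N ->
  (S4 K d).@[x 0] = cyclic_form d.-1 (inord 0) (inord 1) (inord 2) (inord 3)
    (inord 4) (inord 5) x.
Proof.
case: d => // n _; rewrite /S4 /cyclic_form subn1 /=.
have mevalXn (i : 'I_6) k : ('X_i ^+ k : {mpoly K[6]}).@[x 0] = x 0 i ^+ k.
  by rewrite rmorphXn /= mevalXU.
by rewrite !(mevalD, mevalM) !mevalXn !mevalXU.
Qed.

Theorem theorem20 (R : realType) (d : nat) (hd : (5 <= d)%N) :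
  is_slice_rank (S4 (complex R) d) 4.
Proof.
split=> [|s /slice_decomposition_kernel[A vanish]].
  by apply: has_slice_decomposition_S4; lia.
rewrite leqNgt; apply/negP => s4.
have xE (i j : nat) : (i < 6)%N -> (j < 6)%N ->
    ((inord i : 'I_6) == inord j) = (i == j).
  by move=> i6 j6; rewrite -val_eqE /= !inordK.
apply: (@no_vanishing_kernel (complex R) s d.-1 A (inord 0) (inord 1) (inord 2)
  (inord 3) (inord 4) (inord 5)) => //; first by lia.
- by rewrite /= !inE !xE.
- move=> i; rewrite -(inord_val i) !inE.
  by case: i => [[|[|[|[|[|[|i]]]]]]] //= i6; rewrite !xE.
by move=> x /vanish <-; rewrite meval_S4 //; lia.
Qed.
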